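(* Let $n$ be a positive integer and let $G$ be a $P_4$-free bipartite graph with $n$ vertices in each part. Then $\tilde h(G)\ge n/3$. This bound is tight for $n\equiv 0 \pmod 3$, i.e., for every positive integer $n$ divisible by $3$ there is a $P_4$-free bipartite graph $G$ with $n$ vertices in each part and $\tilde h(G)=n/3$.
   Context: All graphs are finite. A bipartite graph $G=((U,V),E)$ comes with a fixed ordered pair of parts (top part $U$, bottom part $V$) and $E\subseteq U\times V$. $\tilde\omega(G)$ is the largest integer $t$ such that there are $A\subseteq U$, $B\subseteq V$ with $|A|=|B|=t$ and $ab\in E$ for all $a\in A,b\in B$; $\tilde\alpha(G)$ is the largest integer $t$ such that there are $A\subseteq U$, $B\subseteq V$ with $|A|=|B|=t$ and $ab\notin E$ for all $a\in A$, $b\in B$; $\tilde h(G)=\max\{\tilde\alpha(G),\tilde\omega(G)\}$. A copy of $H=((X,Y),E_H)$ in $G$ is an induced copy respecting sides: injections $\phi:X\to U$ and $\psi:Y\to V$ with $xy\in E_H$ if and only if $\phi(x)\psi(y)\in E$, for all $x\in X$, $y\in Y$. $G$ is $H$-free if it contains no copy of $H$. $P_4$ is the path on 4 vertices, with two vertices in each part. *)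

(* Defs.v *)
From mathcomp Require Import all_boot all_order all_algebra.

Set Implicit Arguments.
Unset Strict Implicit.
Unset Printing Implicit Defensive.

Record bigraph := Bigraph {
  top : finType;
  bottom : finType;
  edge : top -> bottom -> bool
}.

(* The pair (set0, set0) satisfies both conditions below, so each maximum is
   taken over a nonempty family and is attained. *)
Definition omega_tilde (G : bigraph) : nat :=
  \max_(AB : {set top G} * {set bottom G} |
          (#|AB.1| == #|AB.2|)
          && [forall a in AB.1, forall b in AB.2, edge a b]) #|AB.1|.

Definition alpha_tilde (G : bigraph) : nat :=
  \max_(AB : {set top G} * {set bottom G} |
          (#|AB.1| == #|AB.2|)
          && [forall a in AB.1, forall b in AB.2, ~~ edge a b]) #|AB.1|.

Definition h_tilde (G : bigraph) : nat := maxn (alpha_tilde G) (omega_tilde G).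

Definition has_copy (H G : bigraph) : Prop :=
  exists (phi : top H -> top G) (psi : bottom H -> bottom G),
    [/\ injective phi, injective psi
      & forall x y, edge x y <-> edge (phi x) (psi y)].

Definition is_free (H G : bigraph) : Prop := ~ has_copy H G.

(* The path x0 - y0 - x1 - y1, with x0, x1 in the top part and y0, y1 in the
   bottom part: of the four pairs only x0 y1 is not an edge. *)
Definition P4 : bigraph :=
  @Bigraph 'I_2 'I_2
    (fun x y => (val x, val y) \in [:: (0, 0); (1, 0); (1, 1)]).

(* Main.v *)
Require Import Defs.
From mathcomp Require Import all_boot all_order all_algebra.
From mathcomp Require Import zify.
Import Order.TTheory GRing.Theory Num.Theory.

(** In a [P4]-free bipartite graph two top vertices with a common neighbour
    have the same neighbourhood ([free_nbh_eq]): otherwise a vertex seen by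
    only one of them completes an induced path.  Distinct neighbourhoods are
    therefore disjoint, and the graph is a disjoint union of bicliques plus
    isolated vertices.

    Lower bound ([leq_3h_tilde]).  Put [h = h_tilde G], assume [h < n/3], and
    call a set large if it has more than [h] vertices.  Among the large unions
    of twin classes (classes of top vertices with equal neighbourhoods) take
    one, [A], of least cardinality, and let [C] be one of its classes, with
    neighbourhood [N].
    - If [C] is large, then [(C, N)] is complete and [(C, ~: N)] has no edge,
      and one of [N], [~: N] is large.
    - Otherwise [A :\: C] is not large either, by minimality, so [A] has at
      most [2h] vertices and both [A] and [~: A] are large.  As [A] is a union
      of classes, neither [(A, ~: N(A))] nor [(~: A, N(A))] contains an edge,
      and again one of [N(A)], [~: N(A)] is large.
    Either way a complete or an edgeless pair of large sets contradicts the
    definition of [h].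

    Tightness.  Three disjoint copies of the complete bipartite graph [K_k,k]
    have [3k] vertices in each part.  A biclique lies in one copy, so its sides
    have at most [k] vertices; the two sides of an empty pair meet disjoint
    sets of copies, so one of them lies in a single copy.  The opposite
    inequality is the general lower bound. *)

Definition nbh (G : bigraph) (x : top G) : {set bottom G} := [set y | edge x y].

Definition nbhs (G : bigraph) (A : {set top G}) : {set bottom G} :=
  \bigcup_(x in A) nbh G x.

(** The unions of twin classes, described without naming the classes. *)
Definition twin_closed (G : bigraph) (A : {set top G}) : bool :=
  [forall x in A, forall x', (nbh G x' == nbh G x) ==> (x' \in A)].

(** * Balanced pairs *)

(** The maximum in the definitions of [omega_tilde] and [alpha_tilde] ranges
    over pairs of equal cardinality; shrinking both sides of a pair keeps the
    relation [e], so only a lower bound on each side matters. *)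
Lemma leq_max_balanced (T1 T2 : finType) (e : T1 -> T2 -> bool)
    (A : {set T1}) (B : {set T2}) (m : nat) :
  m <= #|A| -> m <= #|B| -> (forall a b, a \in A -> b \in B -> e a b) ->
  m <= \max_(AB : {set T1} * {set T2} |
          (#|AB.1| == #|AB.2|) && [forall a in AB.1, forall b in AB.2, e a b])
          #|AB.1|.
Proof.
move=> /card_geqP[s [s_uniq s_size sA]] /card_geqP[t [t_uniq t_size tB]] eAB.
have card_s : #|[set x in s]| = m by rewrite cardsE (card_uniqP s_uniq).
have card_t : #|[set y in t]| = m by rewrite cardsE (card_uniqP t_uniq).
rewrite -{1}card_s.
apply: (leq_bigmax_cond ([set x in s], [set y in t])) => /=.
rewrite card_s card_t eqxx /=.
apply/forall_inP => a; rewrite inE => /sA aA.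
by apply/forall_inP => b; rewrite inE => /tB bB; apply: eAB.
Qed.

Lemma complete_leq_h (G : bigraph) (A : {set top G}) (B : {set bottom G}) m :
  m <= #|A| -> m <= #|B| -> (forall a b, a \in A -> b \in B -> edge a b) ->
  m <= h_tilde G.
Proof.
by move=> mA mB eAB; rewrite leq_max (leq_max_balanced _ _ _ _ _ _ mA mB eAB) orbT.
Qed.

Lemma empty_leq_h (G : bigraph) (A : {set top G}) (B : {set bottom G}) m :
  m <= #|A| -> m <= #|B| -> (forall a b, a \in A -> b \in B -> ~~ edge a b) ->
  m <= h_tilde G.
Proof.
move=> mA mB eAB; rewrite leq_max.
by rewrite (leq_max_balanced _ _ (fun x y => ~~ edge x y) _ _ _ mA mB eAB).
Qed.

(** * Structure of P4-free graphs *)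

(** Forbidding induced paths amounts to a closure property of [edge] in which
    the vertices need not be distinct: it is trivial when two of them
    coincide. *)
Lemma P4_freeP (G : bigraph) :
  is_free P4 G <->
  forall (x x' : top G) (y y' : bottom G),
    edge x y -> edge x' y -> edge x' y' -> edge x y'.
Proof.
split=> [freeG x x' y y' xy x'y x'y' | closeG [phi [psi [_ _ edgeP]]]].
  apply/negPn/negP => xy'; apply: freeG.
  (* Distinctness is automatic: a coincidence would force the edge [x y']. *)
  have neq_x : x != x' by apply: contraNneq xy' => ->.
  have neq_y : y != y' by apply: contraNneq xy' => <-.
  exists (fun i : 'I_2 => if val i == 0 then x else x').
  exists (fun j : 'I_2 => if val j == 0 then y else y').
  split.
  - by move=> [[|[|//]] i2] [[|[|//]] j2] /= eq_x; apply: val_inj => //=;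
      move: neq_x; rewrite eq_x eqxx.
  - by move=> [[|[|//]] i2] [[|[|//]] j2] /= eq_y; apply: val_inj => //=;
      move: neq_y; rewrite eq_y eqxx.
  - by move=> [[|[|//]] i2] [[|[|//]] j2]; rewrite /= ?xy ?x'y ?x'y' ?(negPf xy').
pose i0 : top P4 := ord0; pose i1 : top P4 := ord_max.
pose j0 : bottom P4 := ord0; pose j1 : bottom P4 := ord_max.
have e00 : edge (phi i0) (psi j0) by apply/edgeP.
have e10 : edge (phi i1) (psi j0) by apply/edgeP.
have e11 : edge (phi i1) (psi j1) by apply/edgeP.
by have /edgeP := closeG _ _ _ _ e00 e10 e11.
Qed.

Lemma free_nbh_eq (G : bigraph) (x x' : top G) (y : bottom G) :
  is_free P4 G -> edge x y -> edge x' y -> nbh G x = nbh G x'.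
Proof.
move=> /P4_freeP closeG xy x'y; apply/setP => z; rewrite !inE.
by apply/idP/idP => [xz | x'z]; [apply: closeG x'y xy xz | apply: closeG xy x'y x'z].
Qed.

Lemma twin_closedP (G : bigraph) (A : {set top G}) :
  reflect (forall x x', x \in A -> nbh G x' = nbh G x -> x' \in A)
          (twin_closed G A).
Proof.
apply: (iffP forall_inP) => [clA x x' xA /eqP eqN | clA x xA].
  exact: (implyP (forallP (clA x xA) x')).
by apply/forallP => x'; apply/implyP => /eqP; apply: clA.
Qed.

(** This is what makes a minimal union of classes useful: it can be shrunk by
    one whole class at a time. *)
Lemma twin_closedD (G : bigraph) (A : {set top G}) (x : top G) :
  twin_closed G A -> twin_closed G (A :\: [set x' | nbh G x' == nbh G x]).
Proof.
move=> /twin_closedP clA; apply/twin_closedP => u v.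
by rewrite !inE => /andP[Nux uA] Nvu; rewrite Nvu Nux (clA u).
Qed.

(** * The lower bound *)

(** Write [h] for [h_tilde G] and suppose [3 * h < n].  A set is large when it
    has more than [h] vertices; the complement of a set that is not large then
    has at least [2h + 1] vertices, hence is large.  It suffices to exhibit a
    complete or an empty pair of large sets. *)
Lemma leq_3h_tilde (G : bigraph) (n : nat) :
  is_free P4 G -> #|top G| = n -> #|bottom G| = n -> n <= 3 * h_tilde G.
Proof.
move=> freeG card_top card_bot; rewrite leqNgt; apply/negP => lt_3h_n.
set h := h_tilde G in lt_3h_n.
have no_complete (A : {set top G}) (B : {set bottom G}) : h < #|A| -> h < #|B| ->
    (forall a b, a \in A -> b \in B -> edge a b) -> False.
  by move=> hA hB eAB; have := complete_leq_h G A B h.+1 hA hB eAB; rewrite ltnn.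
have no_empty (A : {set top G}) (B : {set bottom G}) : h < #|A| -> h < #|B| ->
    (forall a b, a \in A -> b \in B -> ~~ edge a b) -> False.
  by move=> hA hB eAB; have := empty_leq_h G A B h.+1 hA hB eAB; rewrite ltnn.
have cardC_top (A : {set top G}) : #|A| + #|~: A| = n by rewrite cardsC.
have cardC_bot (B : {set bottom G}) : #|B| + #|~: B| = n by rewrite cardsC.
pose large_closed (A : {set top G}) := twin_closed G A && (h < #|A|).
have large_setT : large_closed [set: top G].
  apply/andP; split; last by rewrite cardsT card_top; lia.
  by apply/twin_closedP => x x'; rewrite !inE.
case: (arg_minnP (fun A : {set top G} => #|A|) large_setT).
move=> A /andP[clA hA] minA.
have /card_gt0P[x xA] : 0 < #|A| by lia.
set C := [set x' | nbh G x' == nbh G x].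
have edgeC a b : a \in C -> edge a b = (b \in nbh G x).
  by rewrite inE => /eqP <-; rewrite inE.
have [leC | hC] := leqP #|C| h; last first.
  have [leN | hN] := leqP #|nbh G x| h; last first.
    by apply: (no_complete C (nbh G x)) => // a b aC bN; rewrite edgeC.
  apply: (no_empty C (~: nbh G x)) => // [|a b aC].
    by have := cardC_bot (nbh G x); lia.
  by rewrite inE edgeC.
have leA : #|A| <= h + h.
  have CA : C \subset A.
    by apply/subsetP => x'; rewrite inE => /eqP; apply: (twin_closedP G A clA).
  have C_gt0 : 0 < #|C| by apply/card_gt0P; exists x; rewrite inE.
  have cardA : #|A :\: C| + #|C| = #|A|.
    by rewrite addnC -{1}(setIidPr CA) cardsID.
  have [leAC | hAC] := leqP #|A :\: C| h; first by lia.
  have /minA : large_closed (A :\: C) by rewrite /large_closed twin_closedD.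
  by lia.
have [leN | hN] := leqP #|nbhs G A| h.
  apply: (no_empty A (~: nbhs G A)) => // [|a b aA].
    by have := cardC_bot (nbhs G A); lia.
  by rewrite inE; apply: contra => ab; apply/bigcupP; exists a; rewrite ?inE.
apply: (no_empty (~: A) (nbhs G A)) => // [|a b].
  by have := cardC_top A; lia.
rewrite inE => aNA /bigcupP[u uA]; rewrite inE => ub.
apply: contra aNA => ab.
exact: (twin_closedP G A clA u a uA (free_nbh_eq G a u b freeG ab ub)).
Qed.

(** * Disjoint copies of a complete bipartite graph *)

Definition copies_biclique (c k : nat) : bigraph :=
  @Bigraph ('I_c * 'I_k)%type ('I_c * 'I_k)%type (fun x y => x.1 == y.1).

Lemma copies_biclique_free (c k : nat) : is_free P4 (copies_biclique c k).
Proof. by apply/P4_freeP => x x' y y' /= /eqP-> /eqP<-. Qed.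

(** A set of vertices is covered by the copies that it meets, [k] vertices
    each. *)
Lemma card_leq_copies (c k : nat) (A : {set 'I_c * 'I_k}) :
  #|A| <= #|[set x.1 | x in A]| * k.
Proof.
rewrite -[X in _ * X](card_ord k) -cardsT -cardsX.
by apply/subset_leq_card/subsetP => x xA; rewrite !inE (imset_f _ xA).
Qed.

Lemma omega_copies_biclique (c k : nat) : omega_tilde (copies_biclique c k) <= k.
Proof.
apply/bigmax_leqP => -[A B] /= /andP[/eqP eqAB /forall_inP eAB].
have [A0|[a aA]] := set_0Vmem A; first by rewrite A0 cards0.
have /card_gt0P[b bB] : 0 < #|B| by rewrite -eqAB; apply/card_gt0P; exists a.
apply: leq_trans (card_leq_copies _ _ A) _.
rewrite -[leqRHS]mul1n leq_mul2r -(cards1 b.1) subset_leq_card ?orbT //.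
apply/subsetP => _ /imsetP[x xA ->].
by rewrite inE; apply: (forall_inP (eAB x xA)).
Qed.

(** The sides of an empty pair meet disjoint sets of copies; of three copies,
    one of the sides therefore meets at most one. *)
Lemma alpha_copies_biclique (k : nat) : alpha_tilde (copies_biclique 3 k) <= k.
Proof.
apply/bigmax_leqP => -[A B] /= /andP[/eqP eqAB /forall_inP eAB].
have := card_leq_copies _ _ A; have := card_leq_copies _ _ B.
set I := [set x.1 | x in A]; set J := [set x.1 | x in B].
have IJ : #|I| + #|J| <= 3.
  have IJ0 : [disjoint I & J].
    rewrite disjoint_subset; apply/subsetP => _ /imsetP[a aA ->].
    apply/imsetP => -[b bB eq_ab].
    by have := forall_inP (eAB a aA) b bB; rewrite eq_ab eqxx.
  rewrite -cardsUI (disjoint_setI0 IJ0) cards0 addn0.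
  by rewrite -[leqRHS](card_ord 3) max_card.
rewrite -eqAB => leB leA.
have [I1|J1] : #|I| <= 1 \/ #|J| <= 1 by lia.
- by apply: leq_trans leA _; rewrite -[leqRHS]mul1n leq_mul2r I1 orbT.
- by apply: leq_trans leB _; rewrite -[leqRHS]mul1n leq_mul2r J1 orbT.
Qed.

Local Open Scope ring_scope.

Theorem lemma5 (n : nat) (n_gt0 : (0 < n)%N) :
  (forall G : bigraph, is_free P4 G -> #|top G| = n -> #|bottom G| = n ->
     n%:R / 3%:R <= (h_tilde G)%:R :> rat)
  /\
  ((3 %| n)%N ->
     exists G : bigraph,
       [/\ is_free P4 G, #|top G| = n, #|bottom G| = n
         & (h_tilde G)%:R = n%:R / 3%:R :> rat]).
Proof.
split=> [G freeG card_top card_bot | /dvdnP[k n_eq]].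
  rewrite ler_pdivrMr ?ltr0n // -natrM ler_nat mulnC.
  exact: leq_3h_tilde.
have freeG := copies_biclique_free 3 k.
have card_G : #|{: 'I_3 * 'I_k}| = n by rewrite card_prod !card_ord n_eq mulnC.
exists (copies_biclique 3 k); split=> //.
have h_le : (h_tilde (copies_biclique 3 k) <= k)%N.
  by rewrite geq_max alpha_copies_biclique omega_copies_biclique.
have h_ge := leq_3h_tilde _ n freeG card_G card_G.
have -> : h_tilde (copies_biclique 3 k) = k by lia.
by rewrite n_eq natrM mulfK // pnatr_eq0.
Qed.
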